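(* Let $A \in \mathbb{C}^{d\times d}$, $\phi \in \mathbb{C}^d$ and $L \in \mathbb{N}$ be such that $\{A^\ell \phi\}_{\ell=0}^{L-1}$ is a full-spark frame for $\mathbb{C}^d$, let $\alpha_1, \alpha_2 \in \mathbb{R}$ satisfy $\alpha_1 - \alpha_2 \notin \pi\mathbb{Z}$, and let $J \in \{0,\dots,d-2\}$. If $L \ge \frac{(d+1)^2}{4(J+1)} + d$, then every $x \in \mathbb{C}^d$ can be recovered up to global phase from the samples $$\bigl\{ |\langle x, A^\ell \phi \rangle| \bigr\}_{\ell=0}^{L-1} \cup \bigl\{ |\langle x, A^\ell (\phi + e^{\mathrm{i}\alpha_k} A^j\phi) \rangle| \bigr\}_{\ell=0,\,k=1,\,j=1}^{L-2,\,2,\,J+1}.$$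
   Context: A finite family of vectors is a frame for $\mathbb{C}^d$ if it spans $\mathbb{C}^d$. A frame $\{f_k\}_{k=0}^{L-1}$ for $\mathbb{C}^d$ (an indexed family, $L\ge d$) has full spark, i.e. is a full-spark frame, if every subfamily of $d$ elements (with distinct indices) spans $\mathbb{C}^d$. $\langle\cdot,\cdot\rangle$ is the standard Hermitian inner product on $\mathbb{C}^d$, linear in the first argument. The samples are indexed families: the values $|\langle x, A^\ell \phi\rangle|$ for each $\ell \in \{0,\dots,L-1\}$ and $|\langle x, A^\ell(\phi + e^{\mathrm{i}\alpha_k}A^j\phi)\rangle|$ for each $\ell\in\{0,\dots,L-2\}$, $k\in\{1,2\}$ and $j\in\{1,\dots,J+1\}$ are known together with their indices; $A$, $\phi$, $\alpha_1$, $\alpha_2$ are known. A vector $x$ ''can be recovered up to global phase'' from the samples if every $y \in \mathbb{C}^d$ having the same samples as $x$ is of the form $y = e^{\mathrm{i}\theta}x$ for some $\theta\in\mathbb{R}$. *)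

(* Defs.v *)
From mathcomp Require Import all_boot all_order all_algebra.
From mathcomp Require Import complex.
From mathcomp Require Import reals trigo.

Set Implicit Arguments.
Unset Strict Implicit.
Unset Printing Implicit Defensive.

Import Order.TTheory GRing.Theory Num.Theory.
Local Open Scope ring_scope.
Local Open Scope complex_scope.

Definition cis (R : realType) (t : R) : R[i] := cos t +i* sin t.

(* [dotmx] is the Hermitian product on row vectors, linear in its first
   argument; here it is transported to column vectors. *)
Definition hdot (R : realType) (d : nat) (x y : 'cV[R[i]]_d) : R[i] :=
  dotmx x^T y^T.

Definition is_frame (R : realType) (d L : nat) (f : 'I_L -> 'cV[R[i]]_d) :
  Prop :=
  <<[seq f k | k : 'I_L]>>%VS = fullv.

(* The bound [d <= L] cannot be dropped: for [L < d] the condition on the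
   subfamilies of [d] elements is vacuous. *)
Definition full_spark_frame (R : realType) (d L : nat)
  (f : 'I_L -> 'cV[R[i]]_d) : Prop :=
  [/\ (d <= L)%N,
      is_frame f
    & forall s : {set 'I_L}, #|s| = d -> <<[seq f k | k in s]>>%VS = fullv].

(* The second component holds the samples
   [|<x, A^l (phi + e^(i alpha_k) A^j phi)>|] for [l <= L - 2]; the shift
   [j] ranges over [1 .. J + 1] and is encoded by [j.-1 : 'I_J.+1]. *)
Definition samples (R : realType) (d : nat) (A : 'M[R[i]]_d)
  (phi : 'cV[R[i]]_d) (L : nat) (alpha1 alpha2 : R) (J : nat)
  (x : 'cV[R[i]]_d) :
  {ffun 'I_L -> R[i]} * {ffun 'I_L.-1 * 'I_2 * 'I_J.+1 -> R[i]} :=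
  ([ffun l : 'I_L => `|hdot x (A ^+ l *m phi)|],
   [ffun lkj : 'I_L.-1 * 'I_2 * 'I_J.+1 =>
      let: (l, k, j) := lkj in
      let alpha := tnth [tuple alpha1; alpha2] k in
      `|hdot x (A ^+ l *m (phi + cis alpha *: (A ^+ j.+1 *m phi)))|]).

Definition recoverable_up_to_phase (R : realType) (d : nat) (T : Type)
  (S : 'cV[R[i]]_d -> T) (x : 'cV[R[i]]_d) : Prop :=
  forall y : 'cV[R[i]]_d, S y = S x -> exists theta : R, y = cis theta *: x.

(* Main.v *)
Require Import Defs.
From mathcomp Require Import all_boot all_order all_algebra.
From mathcomp Require Import complex.
From mathcomp Require Import reals trigo.
From mathcomp Require Import ring lra zify.

(** Write [a l] and [b l] for the products of [x] and [y] with the [l]-th frame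
    vector, and put [K = J + 1].  Equal samples give [|a l| = |b l|] for
    [l < L].  Polarization at the two angles, which is where
    [alpha1 - alpha2] must avoid the multiples of [pi], gives
    [(a l)^* a m = (b l)^* b m] for all indices [l < m < L] at distance at
    most [K] ([eq_samples_cross]).  Only shifted samples with both vectors in
    the frame are needed.

    Where [a] does not vanish, the ratio [b l / a l] has modulus one, and it
    takes the same value at two nonvanishing indices at distance at most [K].
    A new value of the ratio can thus appear only after [K] consecutive zeros
    of [a]: with [z] zeros there are at most [1 + z / K] values
    ([gaps_between_classes]).  If [z >= d], any phase fits the zeros.  Suppose
    that [z < d] and that each value [v] is taken at most [d - 1 - z] times.
    Counting the indices gives [K (L - z) <= (z + K) (d - 1 - z)], hence
    [L <= d - 1 + z (d - 1 - z) / K <= d - 1 + (d - 1) ^ 2 / (4 K)],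
    against the hypothesis on [L].  So some [v] of modulus one satisfies
    [b l = v * a l] for at least [d] indices, the zeros of [a] included
    ([common_phase]).  Then [y - v *: x] is orthogonal to [d] vectors of a
    full-spark frame and is zero ([full_spark_eq0]); finally [v] is the
    exponential of an imaginary number ([cis_surj]). *)

Import Order.TTheory GRing.Theory Num.Theory.
Local Open Scope ring_scope.
Local Open Scope complex_scope.

(** * Counting the values of a function that is constant across short gaps *)

Lemma size_undup_mul_bound {T : eqType} (s : seq T) (c : nat) :
  (forall v, v \in s -> (count_mem v s <= c)%N) ->
  (size s <= size (undup s) * c)%N.
Proof.
move=> hc; rewrite -(perm_size (perm_count_undup s)) size_flatten /shape.
rewrite -map_comp.
have {hc}: forall v, v \in undup s -> (count_mem v s <= c)%N.
  by move=> v; rewrite mem_undup; apply: hc.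
elim: (undup s) => //= v t IH hc; rewrite size_nseq mulSn leq_add //.
  by apply: hc; rewrite mem_head.
by apply: IH => w wt; apply: hc; rewrite in_cons wt orbT.
Qed.

(** If [g] takes the same value at any two [p]-indices at distance at most [K],
    then any two successive [p]-indices with different values are separated by
    at least [K] indices outside [p]. *)
Lemma gaps_between_classes {T : eqType} (K n : nat) (p : pred nat)
    (g : nat -> T) :
  (forall i j, (i < j < n)%N -> (j <= i + K)%N -> p i -> p j -> g i = g j) ->
  ((size (undup [seq g i | i <- iota 0 n & p i])).-1 * K
     <= count (predC p) (iota 0 n))%N.
Proof.
move=> hg.
pose V m := [seq g i | i <- iota 0 m & p i].
pose z m := count (predC p) (iota 0 m).
have VS m : V m.+1 = if p m then rcons (V m) (g m) else V m.
  rewrite /V -addn1 iotaD filter_cat map_cat add0n /=.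
  by case: ifP => _ /=; rewrite ?cats1 ?cats0.
have zS m : z m.+1 = (z m + ~~ p m)%N.
  by rewrite /z -addn1 iotaD count_cat add0n /= addn0.
(* The term [m - i.+1] counts the indices outside [p] after the last [p]-index
   [i] before [m], which have not been charged to a gap yet. *)
suff H m : (m <= n)%N -> V m = [::] \/ exists i,
    [/\ (i < m)%N, p i & ((size (undup (V m))).-1 * K + (m - i.+1) <= z m)%N].
  rewrite -/(V n); have [//|->//|[i [_ _]]] := H n.
  by apply: leq_trans; rewrite leq_addr.
elim: m => [|m IH] ltmn; first by left.
rewrite VS zS; case: (boolP (p m)) => pm; last first.
  have [->|[i [im pi hi]]] := IH (ltnW ltmn); [by left | right; exists i].
  by split=> //=; lia.
right; exists m; split=> //; rewrite subnn addn0 addn0.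
have [->//|[i [im pi hi]]] := IH (ltnW ltmn).
have Vi : g i \in V m by apply: map_f; rewrite mem_filter pi mem_iota.
have s_gt0 : (0 < size (undup (V m)))%N.
  by rewrite -mem_undup in Vi; case: (undup _) Vi.
have size_rcons_undup : (size (undup (rcons (V m) (g m))) + (g m \in V m) =
    (size (undup (V m))).+1)%N.
  rewrite undup_rcons size_rcons size_filter addSn.
  rewrite -(mem_undup (V m)) -(count_uniq_mem _ (undup_uniq _)) addnC.
  by rewrite -(count_predC (pred1 (g m)) (undup (V m))).
have [ltmK|leKm] := ltnP (m - i.+1) K.
  have gE : g i = g m by apply: hg => //; lia.
  by rewrite gE in Vi; rewrite Vi in size_rcons_undup; nia.
by case: (g m \in V m) size_rcons_undup; nia.
Qed.

(** The indices outside [p], together with the [p]-indices where [g] takes a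
    well-chosen value, number more than [e]; the first alternative also covers
    an empty [p]. *)
Lemma large_class {T : eqType} (K n e : nat) (p : pred nat) (g : nat -> T) :
  (forall i j, (i < j < n)%N -> (j <= i + K)%N -> p i -> p j -> g i = g j) ->
  (e ^ 2 + 4 * K * e < 4 * K * n)%N ->
  let z := count (predC p) (iota 0 n) in
  (e < z)%N \/ exists2 i, (i < n)%N && p i &
    (e < count [pred j | p j && (g j == g i)] (iota 0 n) + z)%N.
Proof.
move=> /gaps_between_classes; set s := [seq _ | _ <- _ & _] => gapz hn z.
have countV v : count_mem v s = count [pred j | p j && (g j == v)] (iota 0 n).
  rewrite count_map count_filter; apply: eq_count => j /=; exact: andbC.
have size_s : (size s + z = n)%N.
  by rewrite size_map size_filter count_predC size_iota.
have [/hasP[v vs hv]|/hasPn hs] :=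
    boolP (has (fun v => e < count_mem v s + z)%N s).
  right; case/mapP: vs => i; rewrite mem_filter mem_iota => /andP[pi ltin] vE.
  by exists i; rewrite -?vE -?countV // pi andbT; case/andP: ltin.
left; rewrite ltnNge; apply/negP => lez.
have := @size_undup_mul_bound _ s (e - z) _.
have /[swap]/[apply] : forall v, v \in s -> (count_mem v s <= e - z)%N.
  by move=> v /hs; rewrite -leqNgt; lia.
case E: (size (undup s)) gapz => [|r] /= gapz; first by nia.
rewrite -/z in gapz => hsize.
(* [K (n - z) <= (r + 1) K (e - z) <= (z + K) (e - z)], and
   [4 z (e - z) <= e ^ 2] *)
have h1 : (K * size s <= (z + K) * (e - z))%N.
  apply: leq_trans (leq_mul (leqnn K) hsize) _.
  by rewrite mulnA leq_mul //; lia.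
have h2 : (4 * (z * (e - z)) <= e ^ 2)%N.
  by have := (nat_AGM2 z (e - z)).1; rewrite subnKC.
have zK : (z + (e - z) = e)%N by rewrite subnKC.
by nia.
Qed.

Lemma count_iota_leq_card (n : nat) (q q' : pred nat) :
  (forall l : 'I_n, q l -> q' l) ->
  (count q (iota 0 n) <= #|[pred l : 'I_n | q' l]|)%N.
Proof.
move=> qq'; rewrite cardE size_filter -val_enum_ord count_map enumT.
exact: sub_count.
Qed.

(** * Complex numbers and polarization *)

Lemma sin_eq0_pi {R : realType} (t : R) :
  sin t = 0 -> exists m : int, t = pi * m%:~R.
Proof.
move=> st; have pi0 := pi_gt0 R.
pose m := Num.floor (t / pi); pose u := t - pi * m%:~R.
have shift (n : nat) (v : R) : sin (v + pi *+ n) = 0 <-> sin v = 0.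
  rewrite (alternatingn (@sinDpi R)); split=> [/eqP|->]; last by rewrite mulr0.
  by rewrite mulf_eq0 signr_eq0 => /eqP.
have su : sin u = 0.
  rewrite /u; case: {u}m => n.
    by apply/(shift n); rewrite -mulr_natr subrK.
  by rewrite NegzE mulrNz mulrN opprK mulr_natr; apply/shift.
have /andP[u_ge0 ult_pi] : 0 <= u < pi.
  have /andP[] := floor_itv (t / pi); rewrite -/m intrD.
  by rewrite ler_pdivlMr // ltr_pdivrMr // /u; lra.
exists m; apply/eqP; rewrite -subr_eq0 -/u; apply/negPn/negP => u0.
by have := @sin_gt0_pi R u; rewrite su ltxx lt0r u0 u_ge0 ult_pi => /(_ isT).
Qed.

Lemma cis_surj {R : realType} (c : R[i]) : `|c| = 1 -> exists t : R, c = cis t.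
Proof.
case: c => a b /(congr1 (fun z => z ^+ 2)).
rewrite -add_Re2_Im2 expr1n => -[/= ab1].
have a1 : -1 <= a <= 1 by nra.
have ca : cos (acos a) = a by rewrite acosK // in_itv.
have sa : sin (acos a) = `|b|.
  by rewrite sin_acos // -sqrtr_sqr; congr Num.sqrt; lra.
have [b0|b0] := ger0P b.
  by exists (acos a); rewrite /cis ca sa ger0_norm.
by exists (- acos a); rewrite /cis cosN sinN ca sa ltr0_norm ?opprK.
Qed.

Lemma sqr_norm_complex {R : rcfType} (u v : R[i]) : `|u| = `|v| ->
  complex.Re u ^+ 2 + complex.Im u ^+ 2 =
  complex.Re v ^+ 2 + complex.Im v ^+ 2.
Proof. by move=> uv; have := add_Re2_Im2 u; rewrite uv -add_Re2_Im2 => -[]. Qed.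

(** Polarization from two angles: [|a + (cis t)^* b| ^ 2] equals
    [|a| ^ 2 + |b| ^ 2 + 2 (cos t Re (a^* b) + sin t Im (a^* b))], and two
    values of [t] that differ by no multiple of [pi] give an invertible linear
    system for the real and imaginary parts of [a^* b]. *)
Lemma polarization {R : realType} (t1 t2 : R) (a b a' b' : R[i]) :
  sin (t1 - t2) != 0 -> `|a| = `|a'| -> `|b| = `|b'| ->
  (forall t, t \in [:: t1; t2] ->
    `|a + (cis t)^* * b| = `|a' + (cis t)^* * b'|) ->
  a^* * b = a'^* * b'.
Proof.
rewrite sinB; move=> s12 /sqr_norm_complex na /sqr_norm_complex nb nab.
have /sqr_norm_complex n1 := nab t1 (mem_head _ _).
have /sqr_norm_complex n2 := nab t2 (mem_last t1 [:: t2]).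
case: a b a' b' na nb n1 n2 {nab}
  => [a1 a2] [b1 b2] [c1 c2] [d1 d2] /= na nb n1 n2.
(* [w1] and [w2] are the real and imaginary parts of [a^* b - a'^* b']. *)
pose w1 := a1 * b1 + a2 * b2 - (c1 * d1 + c2 * d2).
pose w2 := a1 * b2 - a2 * b1 - (c1 * d2 - c2 * d1).
have wE t :
    (a1 + (cos t * b1 - - sin t * b2)) ^+ 2 +
    (a2 + (cos t * b2 + - sin t * b1)) ^+ 2 =
    (c1 + (cos t * d1 - - sin t * d2)) ^+ 2 +
    (c2 + (cos t * d2 + - sin t * d1)) ^+ 2 ->
  cos t * w1 + sin t * w2 = 0.
  have E x1 x2 y1 y2 :
      (x1 + (cos t * y1 - - sin t * y2)) ^+ 2 +
      (x2 + (cos t * y2 + - sin t * y1)) ^+ 2 =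
      x1 ^+ 2 + x2 ^+ 2 + (y1 ^+ 2 + y2 ^+ 2) +
      2 * (cos t * (x1 * y1 + x2 * y2) + sin t * (x1 * y2 - x2 * y1)).
    rewrite -[y1 ^+ 2 + y2 ^+ 2]mul1r -{1}(cos2Dsin2 t); ring.
  by rewrite !E na nb /w1 /w2; lra.
have {n1}e1 := wE _ n1; have {n2}e2 := wE _ n2.
have w10 : w1 = 0.
  apply: (mulfI s12); rewrite mulr0.
  rewrite -[RHS](_ : sin t1 * (cos t2 * w1 + sin t2 * w2) -
                     sin t2 * (cos t1 * w1 + sin t1 * w2) = 0).
    by ring.
  by rewrite e1 e2 !mulr0 subr0.
have w20 : w2 = 0.
  apply: (mulfI s12); rewrite mulr0.
  rewrite -[RHS](_ : cos t2 * (cos t1 * w1 + sin t1 * w2) -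
                     cos t1 * (cos t2 * w1 + sin t2 * w2) = 0).
    by ring.
  by rewrite e1 e2 !mulr0 subr0.
by congr Complex; move: w10 w20; rewrite /w1 /w2; lra.
Qed.

(** * The Hermitian product and full-spark frames *)

Lemma hdotE {R : realType} {d : nat} (x y : 'cV[R[i]]_d) :
  hdot x y = \sum_(k < d) x k 0 * (y k 0)^*.
Proof.
by rewrite /hdot dotmxE mxE; apply: eq_bigr => k _; rewrite !mxE.
Qed.

Lemma hdotDl {R : realType} {d : nat} (x y z : 'cV[R[i]]_d) :
  hdot (x + y) z = hdot x z + hdot y z.
Proof.
rewrite !hdotE -big_split; apply: eq_bigr => k _ /=.
by rewrite mxE mulrDl.
Qed.

Lemma hdotZl {R : realType} {d : nat} (c : R[i]) (x z : 'cV[R[i]]_d) :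
  hdot (c *: x) z = c * hdot x z.
Proof.
by rewrite !hdotE mulr_sumr; apply: eq_bigr => k _; rewrite mxE mulrA.
Qed.

Lemma hdotDr {R : realType} {d : nat} (x y z : 'cV[R[i]]_d) :
  hdot x (y + z) = hdot x y + hdot x z.
Proof.
rewrite !hdotE -big_split; apply: eq_bigr => k _ /=.
by rewrite mxE rmorphD mulrDr.
Qed.

Lemma hdotZr {R : realType} {d : nat} (c : R[i]) (x y : 'cV[R[i]]_d) :
  hdot x (c *: y) = c^* * hdot x y.
Proof.
rewrite !hdotE mulr_sumr; apply: eq_bigr => k _.
by rewrite mxE rmorphM mulrCA.
Qed.

Lemma hdot_spanning_eq0 {R : realType} {d : nat} (s : seq 'cV[R[i]]_d)
    (u : 'cV[R[i]]_d) :
  <<s>>%VS = fullv -> (forall f, f \in s -> hdot u f = 0) -> u = 0.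
Proof.
move=> s_span su.
suff u0 : hdot u u = 0.
  apply/trmx_inj/eqP; rewrite trmx0 -(dnorm_eq0 (@dotmx _ d)); exact/eqP.
have : u \in <<s>>%VS by rewrite s_span memvf.
have sP (k : 'I_(size s)) : hdot u s`_k = 0 by rewrite su // mem_nth.
move=> /(@coord_span _ _ _ (in_tuple s)) {2}->; elim/big_rec: _ => [|k w _ w0].
  by rewrite -(scale0r u) hdotZr rmorph0 mul0r.
by rewrite hdotDr w0 hdotZr /= sP mulr0 addr0.
Qed.

Lemma full_spark_eq0 {R : realType} {d L : nat} (f : 'I_L -> 'cV[R[i]]_d)
    (u : 'cV[R[i]]_d) :
  full_spark_frame f -> (d <= #|[pred l | hdot u (f l) == 0%R]|)%N -> u = 0.
Proof.
move=> [_ _ sparkf]; rewrite cardE => hd.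
pose s := [set l in take d (enum [pred l | hdot u (f l) == 0%R])].
have cards : #|s| = d.
  have /card_uniqP := take_uniq d (enum_uniq [pred l | hdot u (f l) == 0%R]).
  by rewrite cardsE => ->; rewrite size_takel.
apply: hdot_spanning_eq0 (sparkf s cards) _ => v /imageP[l ls ->].
by move: ls; rewrite inE => /mem_take; rewrite mem_enum => /eqP.
Qed.

(** * A common phase at many indices *)

(** Two finite sequences with the same moduli and the same products
    [(a l)^* a m] for indices at distance at most [K] agree up to one common
    phase at more than [e] indices, once they are long enough. *)
Lemma common_phase {R : rcfType} (K n e : nat) (a b : nat -> R[i]) :
  (forall l, (l < n)%N -> `|a l| = `|b l|) ->
  (forall l m, (l < m < n)%N -> (m <= l + K)%N ->
     (a l)^* * a m = (b l)^* * b m) ->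
  (e ^ 2 + 4 * K * e < 4 * K * n)%N ->
  exists2 v : R[i], `|v| = 1 & (e < #|[pred l : 'I_n | b l == (v * a l)%R]|)%N.
Proof.
move=> normab cross hn.
pose p := [pred l | a l != 0]; pose g l := b l / a l.
have normg l : (l < n)%N -> p l -> `|g l| = 1.
  by move=> ltln al0; rewrite normrM normfV -normab // divff ?normr_eq0.
have g_near l m : (l < m < n)%N -> (m <= l + K)%N -> p l -> p m -> g l = g m.
  move=> lm lmK pl pm; have := cross _ _ lm lmK.
  have ltln : (l < n)%N by case/andP: lm; apply: ltn_trans.
  have /(congr1 (fun r => r ^+ 2)) := normab l ltln.
  rewrite !sqr_normc => sq cr; apply/eqP; rewrite eqr_div //; apply/eqP.
  apply: (@mulfI _ (a l)^*); first by rewrite conjc_eq0.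
  by rewrite mulrCA cr mulrA -sq; ring.
have b0 (l : 'I_n) : a l = 0 -> b l = 0.
  by move=> al0; apply/eqP; rewrite -normr_eq0 -normab // al0 normr0.
have [ltez|[i /andP[ltin pi] hi]] := large_class _ _ _ _ _ g_near hn.
  (* The zeros alone suffice, so any phase will do. *)
  exists 1; first exact: normr1.
  apply: leq_trans ltez _.
  apply: (@count_iota_leq_card n _ (fun l => b l == (1 * a l)%R)) => l /=.
  by rewrite negbK => /eqP al0; rewrite b0 // al0 mulr0.
exists (g i); first exact: normg.
have {}hi : (e < count (predU [pred j | p j && (g j == g i)] (predC p))
                       (iota 0 n))%N.
  move: hi; rewrite -count_predUI.
  set c := count (predI _ _) _; suff -> : c = 0%N by rewrite addn0.
  rewrite -[RHS](count_pred0 (iota 0 n)); apply: eq_count => j /=.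
  by case: (a j == 0); rewrite ?andbF.
apply: leq_trans hi _.
apply: (@count_iota_leq_card n _ (fun l => b l == (g i * a l)%R)) => l /=.
rewrite negbK => /orP[/andP[al0 /eqP <-]|/eqP al0]; first by rewrite divfK.
by rewrite b0 // al0 mulr0.
Qed.

(** The bound on [L] in the form in which the counting argument uses it, with
    [d - 1] in place of [d + 1]. *)
Lemma sample_bound {R : realFieldType} (d L J : nat) :
  (0 < d)%N ->
  (d%:R + 1) ^+ 2 / (4 * (J%:R + 1)) + d%:R <= L%:R :> R ->
  (d.-1 ^ 2 + 4 * J.+1 * d.-1 < 4 * J.+1 * L)%N.
Proof.
case: d => // e _; have J0 : 0 < 4 * (J%:R + 1) :> R.
  by rewrite mulr_gt0 // ltr_wpDl ?ler0n.
rewrite -(ler_pM2l J0) mulrDr mulrCA divff ?gt_eqF // mulr1 => h.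
have : ((e.+1 + 1) ^ 2 + 4 * J.+1 * e.+1 <= 4 * J.+1 * L)%N.
  by move: h; rewrite -(ler_nat R) !(natrD, natrM, natrX) -(natr1 J); lra.
by nia.
Qed.

(** * The samples and the recovery theorem *)

Lemma samples_fst {R : realType} {d : nat} (A : 'M[R[i]]_d)
    (phi : 'cV[R[i]]_d) (L : nat) (alpha1 alpha2 : R) (J : nat)
    (x : 'cV[R[i]]_d) (l : 'I_L) :
  (samples A phi L alpha1 alpha2 J x).1 l = `|hdot x (A ^+ l *m phi)|.
Proof. by rewrite /samples [LHS]ffunE. Qed.

Lemma samples_snd {R : realType} {d : nat} (A : 'M[R[i]]_d)
    (phi : 'cV[R[i]]_d) (L : nat) (alpha1 alpha2 : R) (J : nat)
    (x : 'cV[R[i]]_d) (l : 'I_L.-1) (k : 'I_2) (j : 'I_J.+1) :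
  (samples A phi L alpha1 alpha2 J x).2 (l, k, j) =
  `|hdot x (A ^+ l *m phi) +
    (cis (tnth [tuple alpha1; alpha2] k))^* *
      hdot x (A ^+ (l + j.+1) *m phi)|.
Proof.
rewrite /samples [LHS]ffunE; congr `|_|.
by rewrite mulmxDr hdotDr -scalemxAr hdotZr mulmxA exprD.
Qed.

Lemma eq_samples_norm {R : realType} {d : nat} {A : 'M[R[i]]_d}
    {phi : 'cV[R[i]]_d} {L : nat} {alpha1 alpha2 : R} {J : nat}
    {x y : 'cV[R[i]]_d} (l : nat) :
  samples A phi L alpha1 alpha2 J y = samples A phi L alpha1 alpha2 J x ->
  (l < L)%N -> `|hdot x (A ^+ l *m phi)| = `|hdot y (A ^+ l *m phi)|.
Proof.
move=> /(congr1 fst) hyx ltlL; pose l' := Ordinal ltlL.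
transitivity ((samples A phi L alpha1 alpha2 J x).1 l').
  exact/esym/samples_fst.
by rewrite -hyx; apply: samples_fst.
Qed.

Lemma eq_samples_cross {R : realType} {d : nat} {A : 'M[R[i]]_d}
    {phi : 'cV[R[i]]_d} {L : nat} {alpha1 alpha2 : R} {J : nat}
    {x y : 'cV[R[i]]_d} (l m : nat) :
  sin (alpha1 - alpha2) != 0 ->
  samples A phi L alpha1 alpha2 J y = samples A phi L alpha1 alpha2 J x ->
  (l < m < L)%N -> (m <= l + J.+1)%N ->
  (hdot x (A ^+ l *m phi))^* * hdot x (A ^+ m *m phi) =
  (hdot y (A ^+ l *m phi))^* * hdot y (A ^+ m *m phi).
Proof.
move=> sin0 hyx /andP[ltlm ltmL] lemJ.
have ltlL1 : (l < L.-1)%N by lia.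
have ltjJ : (m - l.+1 < J.+1)%N by lia.
(* [m] is reached from [l] by the shift [m - l], encoded by its predecessor. *)
have ml : (l + (m - l.+1).+1 = m)%N by lia.
apply: (@polarization _ alpha1 alpha2 _ _ _ _ sin0).
- exact: eq_samples_norm _ hyx (ltn_trans ltlm ltmL).
- exact: eq_samples_norm _ hyx ltmL.
pose F z k := `|hdot z (A ^+ l *m phi) +
  (cis (tnth [tuple alpha1; alpha2] k))^* * hdot z (A ^+ m *m phi)|.
have samp z k :
    (samples A phi L alpha1 alpha2 J z).2 (Ordinal ltlL1, k, Ordinal ltjJ) =
    F z k.
  have := samples_snd A phi L alpha1 alpha2 J z (Ordinal ltlL1) k
    (Ordinal ltjJ).
  by move=> ->; rewrite /F /= ml.
have {}samp k : F x k = F y k by rewrite -(samp x) -(samp y) hyx.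
move=> t; rewrite !inE => /orP[]/eqP->; first exact: (samp ord0).
exact: (samp ord_max).
Qed.

Theorem theorem5p4 (R : realType) (d : nat) (A : 'M[R[i]]_d)
  (phi : 'cV[R[i]]_d) (L : nat)
  (hspark : full_spark_frame (fun l : 'I_L => A ^+ l *m phi))
  (alpha1 alpha2 : R)
  (halpha : forall m : int, alpha1 - alpha2 <> pi * m%:~R)
  (J : nat) (hJ : (J.+2 <= d)%N)
  (hL : (d%:R + 1) ^+ 2 / (4 * (J%:R + 1)) + d%:R <= L%:R :> R)
  (x : 'cV[R[i]]_d) :
  recoverable_up_to_phase (samples A phi L alpha1 alpha2 J) x.
Proof.
move=> y hyx.
have sin0 : sin (alpha1 - alpha2) != 0.
  by apply/eqP => /sin_eq0_pi[m]; apply: halpha.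
have d_gt0 : (0 < d)%N := ltn_trans (ltn0Sn _) hJ.
have [v vn hv] := common_phase _ _ _ _ _ (fun l => eq_samples_norm l hyx)
  (fun l m => eq_samples_cross l m sin0 hyx) (sample_bound _ _ _ d_gt0 hL).
have [t vE] := cis_surj _ vn; exists t; apply/eqP; rewrite -subr_eq0 -vE.
apply/eqP/(full_spark_eq0 _ _ hspark).
rewrite (prednK d_gt0) in hv; apply: leq_trans hv _.
apply: subset_leq_card; apply/subsetP => l; rewrite !inE => /eqP bl.
by rewrite hdotDl -scaleNr hdotZl bl mulNr subrr.
Qed.
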